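(* Let $p\in(0,1]$ and let $M_1,M_2$ be functions on $[0,1]$ such that $t\mapsto M_1(t^{1/p})$ and $t\mapsto M_2(t^{1/p})$ are Orlicz functions, with fundamental functions $\varphi_{M_1},\varphi_{M_2}$. Let $(\alpha_i)_{i=1}^\infty$ be a non-increasing sequence of non-negative real numbers. For $k\in\mathbb{N}$ set $$\Lambda(k):=\max_{s\in\{1,\dots,k\}}\alpha_{k2^{s-1}}\frac{\varphi_{M_2}(k/s)}{\varphi_{M_1}(k/s)},\qquad \Theta(k):=\max_{k\le n\le 2^{k-1}}\alpha_n\frac{\varphi_{M_2}\left(k/\log(2n/k)\right)}{\varphi_{M_1}\left(k/\log(2n/k)\right)},$$ the second maximum being over integers $n$. Then for each $k\in\mathbb{N}$, $$2^{-2/p}\Lambda(k)\le\Theta(k)\le 2^{1/p}\Lambda(k).$$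
   Context: $\log=\log_2$; $\mathbb{N}=\{1,2,\dots\}$. Orlicz function: a continuous, strictly increasing, convex function $N:[0,1]\to\mathbb{R}$ with $N(0)=0$, $N(1)=1$. Fundamental function: for $M$ on $[0,1]$ such that $t\mapsto M(t^{1/p})$ is an Orlicz function, $\varphi_M(t)=1/M^{-1}(1/t)$ for $t\ge1$, where $M^{-1}$ is the inverse function of $M$. *)

(* Defs.v *)
From HB Require Import structures.
From mathcomp Require Import all_boot all_order all_algebra.
From mathcomp Require Import all_classical all_reals all_analysis.

Set Implicit Arguments.
Unset Strict Implicit.
Unset Printing Implicit Defensive.

Import Order.TTheory GRing.Theory Num.Theory.
Import numFieldNormedType.Exports.

Local Open Scope classical_set_scope.
Local Open Scope ring_scope.

(** Functions on [0,1] are total functions [R -> R] of which only the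
    restriction to [0,1] is ever constrained or used. *)

Record orlicz_function (R : realType) (N : R -> R) : Prop := OrliczFunction {
  orlicz_continuous : {within `[0, 1]%classic, continuous N} ;
  orlicz_increasing : {in `[0, 1] &, {homo N : x y / x < y}} ;
  orlicz_convex : convex_function (`[0, 1]%classic : set R) N ;
  orlicz0 : N 0 = 0 ;
  orlicz1 : N 1 = 1 }.

Definition log2 (R : realType) (x : R) : R := ln x / ln 2.

(** [M] is inverted as a map on [0,1]; meaningful for [1 <= t], where
    [t^-1] lies in [M @` `[0, 1]]. *)
Definition fundamental_function (R : realType) (M : R -> R) (t : R) : R :=
  ('pinv_(fun=> 0) `[0, 1]%classic M t^-1)^-1.

(** Maximum of [F m, ..., F n], for [m <= n]. Taking [F m] itself as the default
    value makes this the maximum irrespective of the sign of [F]. *)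
Definition max_range (R : realType) (m n : nat) (F : nat -> R) : R :=
  \big[Num.max/F m]_(m <= i < n.+1) F i.

(** Sequences [alpha] are indexed from 1; [alpha 0] is never used. *)

Definition Lambda (R : realType) (M1 M2 : R -> R) (alpha : nat -> R)
    (k : nat) : R :=
  max_range 1 k (fun s : nat =>
    alpha (k * 2 ^ s.-1)%N *
      (fundamental_function M2 (k%:R / s%:R) /
       fundamental_function M1 (k%:R / s%:R))).

Definition Theta (R : realType) (M1 M2 : R -> R) (alpha : nat -> R)
    (k : nat) : R :=
  max_range k (2 ^ k.-1)%N (fun n : nat =>
    alpha n *
      (fundamental_function M2 (k%:R / log2 ((2 * n)%:R / k%:R)) /
       fundamental_function M1 (k%:R / log2 ((2 * n)%:R / k%:R)))).

(* Main.v *)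
Require Import Defs.
From HB Require Import structures.
From mathcomp Require Import all_boot all_order all_algebra.
From mathcomp Require Import all_classical all_reals all_analysis.
From mathcomp Require Import ring lra zify.

Import Order.TTheory GRing.Theory Num.Theory.
Import numFieldNormedType.Exports.

Local Open Scope classical_set_scope.
Local Open Scope ring_scope.

(** Concavity of the inverse of [t |-> M (t `^ (1 / p))] makes
    [fundamental_function M t] nondecreasing and
    [fundamental_function M t / t `^ (1 / p)] nonincreasing in [t], so the
    quotient [fundamental_function M2 / fundamental_function M1] drops by a
    factor at most [C `^ (1 / p)] when its argument is multiplied by at most
    [C]. For the upper bound, compare the term of index [n] in [Theta k] with
    the term of index [s], the integer part of [log2 (2 n / k)], in
    [Lambda k]: here [C = 2]. For the lower bound, compare the term of index
    [s] in [Lambda k] with the term of index [minn (k 2^(s-1)) (2^(k-1))] in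
    [Theta k]: here [C = 4], because [k <= 4 (k - log2 k)]. *)

Section MaxRange.
Context (R : realType).
Implicit Types (m n i : nat) (F : nat -> R).

Lemma le_max_range m n F i : (m <= i <= n)%N -> F i <= max_range m n F.
Proof.
move=> /andP[mi i_n]; rewrite /max_range.
by apply: (@le_bigmax_seq _ _ _ _ _ i xpredT) => //; rewrite mem_index_iota mi.
Qed.

Lemma max_range_le m n F (x : R) : (m <= n)%N ->
  (forall i, (m <= i <= n)%N -> F i <= x) -> max_range m n F <= x.
Proof.
move=> mn Fx; rewrite /max_range big_nat_cond; apply: bigmax_le.
  (* The default value [F m] has to be bounded too; it is a term of the range because [m <= n]. *)
  by apply: Fx; rewrite leqnn.
by move=> i; rewrite andbT ltnS => /Fx.
Qed.

End MaxRange.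

Section Log2.
Context (R : realType).
Implicit Types (x y : R) (n : nat).

Let ln2_gt0 : 0 < ln 2 :> R.
Proof. by apply: ln_gt0; rewrite ltr1n. Qed.

Lemma ler_log2 x y : 0 < x -> x <= y -> log2 x <= log2 y.
Proof.
move=> x0 xy; have y0 := lt_le_trans x0 xy.
by rewrite /log2 ler_pM2r ?invr_gt0// ler_ln ?posrE.
Qed.

Lemma log2X x n : 0 < x -> log2 (x ^+ n) = n%:R * log2 x.
Proof. by move=> x0; rewrite /log2 lnXn// mulr_natl mulrnAl. Qed.

Lemma log2_2X n : log2 (2 ^+ n) = n%:R :> R.
Proof. by rewrite log2X// /log2 divff ?mulr1// gt_eqF. Qed.

End Log2.

Section FundamentalFunction.
Context (R : realType).

Lemma powR_itv01 (a r : R) : 0 <= r -> a \in `[0, 1] -> a `^ r \in `[0, 1].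
Proof.
move=> r0; rewrite !in_itv/= powR_ge0/= => /andP[a0 a1].
have <- : 1 `^ r = 1 :> R by rewrite powR1.
by rewrite ge0_ler_powR ?nnegrE.
Qed.

(** Convexity between [b] and 0, with weight [t = N a / N b], gives [N (t * b) <= t * N b = N a],
    and strict monotonicity then removes [N]. The last bound is what concavity of the inverse
    provides: the inverse at [u], divided by [u], is nonincreasing in [u]. *)
Lemma orlicz_inv_le (N : R -> R) (a b : R) : orlicz_function N ->
  a \in `[0, 1] -> b \in `[0, 1] -> 0 < N a -> N a <= N b ->
  [/\ 0 < a, a <= b & N a / N b * b <= a].
Proof.
move=> [_ Ninc Nconv N0 N1] a01 b01 Na_gt0 Nab.
have N_le x y : x \in `[0, 1] -> y \in `[0, 1] -> N x <= N y -> x <= y.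
  by move=> x01 y01; apply: contraTle; rewrite -ltNge => /Ninc; apply.
have /andP[a0 a1] : 0 <= a <= 1 by move: a01; rewrite in_itv.
have /andP[b0 b1] : 0 <= b <= 1 by move: b01; rewrite in_itv.
have Nb_gt0 := lt_le_trans Na_gt0 Nab.
split; last first.
- set t := N a / N b.
  have t0 : 0 <= t by rewrite divr_ge0// ltW.
  have t1 : t <= 1 by rewrite ler_pdivrMr// mul1r.
  have t01 : Itv.spec (@Itv.num_sem R) (Itv.Real `[0%Z, 1%Z]) t.
    by rewrite /= /Itv.num_sem/= num_real/= in_itv/= t0.
  have /= := Nconv (Itv.mk t01) b 0.
  rewrite !convRE /= !inE/= !in_itv/= N0 !mulr0 !addr0 => /(_ _ _).
  rewrite b0 b1 lexx ler01 => /(_ isT isT).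
  rewrite [X in N X](_ : _ = t * b); last first.
    by rewrite /conv/= scaler0 addr0.
  move=> Ntb.
  apply: N_le => //; last by rewrite (le_trans Ntb)// divfK// gt_eqF.
  by rewrite in_itv/= mulr_ge0// mulr_ile1.
- exact: N_le.
- by rewrite lt_neqAle a0 andbT; apply: contraTneq Na_gt0 => <-; rewrite N0 ltxx.
Qed.

Context (p : R) (M : R -> R).
Hypotheses (p_gt0 : 0 < p)
  (orlicz_M : orlicz_function (fun t : R => M (t `^ (1 / p)))).

(** The intermediate value theorem puts [u] in the image of [M], so the pseudo-inverse is a genuine
    preimage; its [p]-th power [a] is a preimage of [u] under the Orlicz function. *)
Lemma pinv_orliczP (u : R) : u \in `[0, 1] ->
  exists2 a, a \in `[0, 1] & M (a `^ (1 / p)) = u /\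
    'pinv_(fun=> 0) `[0, 1]%classic M u = a `^ (1 / p).
Proof.
have p1_ge0 : 0 <= 1 / p by rewrite divr_ge0// ltW.
case: orlicz_M => Mcont _ _ M0 M1 u01.
have [|c] := IVT ler01 Mcont (v := u).
  by rewrite M0 M1 min_l// max_r.
move=> c01 Mc.
have uM : (M @` `[0, 1]%classic) u.
  by exists (c `^ (1 / p)) => //=; exact: powR_itv01.
set h := 'pinv_(fun=> 0) `[0, 1]%classic M u.
have Mh : M h = u by apply: pinvK; rewrite inE.
have h01 : `[0, 1]%classic h.
  apply: (surjpinv_image_sub (B := M @` `[0, 1]%classic) (f := M)) => //.
  by exists u.
have h0 : 0 <= h by move: h01; rewrite /= in_itv => /andP[].
have hp : (h `^ p) `^ (1 / p) = h.
  by rewrite -powRrM mulrCA divff ?gt_eqF// mulr1 powRr1.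
by exists (h `^ p); [apply: powR_itv01 => //; exact: ltW | rewrite hp].
Qed.

(** The Orlicz preimages [a] of [t'^-1] and [b] of [t^-1] satisfy [a <= b <= t' / t * a]; raising to
    the power [- (1 / p)] gives the bounds. *)
Lemma fundamental_function_le (t t' : R) : 1 <= t -> t <= t' ->
  let phi := fundamental_function M in
  [/\ 0 < phi t, phi t <= phi t' & phi t' <= (t' / t) `^ (1 / p) * phi t].
Proof.
move=> t_ge1 tt' /=.
have p1_ge0 : 0 <= 1 / p by rewrite divr_ge0// ltW.
have t_gt0 : 0 < t by rewrite (lt_le_trans ltr01).
have t'_gt0 : 0 < t' by rewrite (lt_le_trans t_gt0).
have inv01 (x : R) : 1 <= x -> x^-1 \in `[0, 1].
  move=> x1; have x0 : 0 < x by exact: lt_le_trans x1.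
  by rewrite in_itv/= invr_ge0 (ltW x0)/= invf_le1.
rewrite /fundamental_function.
have [b b01 [Mb ->]] := pinv_orliczP _ (inv01 _ t_ge1).
have [a a01 [Ma ->]] := pinv_orliczP _ (inv01 _ (le_trans t_ge1 tt')).
have := orlicz_inv_le _ _ _ orlicz_M a01 b01.
rewrite Ma Mb invr_gt0 t'_gt0 lef_pV2 ?posrE// tt' => /(_ isT isT)[a_gt0 ab tba].
have b_gt0 := lt_le_trans a_gt0 ab.
split.
- by rewrite invr_gt0 powR_gt0.
- by rewrite lef_pV2 ?posrE ?powR_gt0// ge0_ler_powR// nnegrE ltW.
- have ba : b <= t' / t * a.
    rewrite mulrAC ler_pdivlMr// mulrC -ler_pdivrMl// mulrA.
    by move: tba; rewrite invrK.
  rewrite ler_pdivlMr ?powR_gt0// mulrC ler_pdivrMr ?powR_gt0//.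
  have t't_ge0 : 0 <= t' / t by rewrite divr_ge0 ?ltW.
  rewrite -powRM ?(ltW a_gt0)//; apply: ge0_ler_powR => //.
  - by rewrite nnegrE ltW.
  - by rewrite nnegrE mulr_ge0 ?(ltW a_gt0).
Qed.

End FundamentalFunction.

(** From [t] to [t'] the numerator does not decrease, while the denominator grows at most by the
    factor in front. *)
Lemma fundamental_function_ratio_le (R : realType) (p : R) (M1 M2 : R -> R)
    (C t t' : R) (phi1 := fundamental_function M1)
    (phi2 := fundamental_function M2) : 0 < p ->
  orlicz_function (fun t : R => M1 (t `^ (1 / p))) ->
  orlicz_function (fun t : R => M2 (t `^ (1 / p))) ->
  1 <= t -> t <= t' -> t' <= C * t ->
  0 <= phi2 t / phi1 t <= C `^ (1 / p) * (phi2 t' / phi1 t').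
Proof.
move=> p_gt0 oM1 oM2 t_ge1 tt' t'Ct.
have t_gt0 : 0 < t by rewrite (lt_le_trans ltr01).
have t'_gt0 : 0 < t' by rewrite (lt_le_trans t_gt0).
have [phi1_gt0 phi1_le phi1_ge] := fundamental_function_le _ _ _ p_gt0 oM1 _ _ t_ge1 tt'.
have [phi2_gt0 phi2_le _] := fundamental_function_le _ _ _ p_gt0 oM2 _ _ t_ge1 tt'.
rewrite -/phi1 -/phi2 in phi1_gt0 phi1_le phi1_ge phi2_gt0 phi2_le *.
have phi1'_gt0 := lt_le_trans phi1_gt0 phi1_le.
apply/andP; split; first by rewrite divr_ge0 ?ltW.
rewrite mulrCA; apply: ler_pM => //; [exact: ltW|by rewrite ltW// invr_gt0|].
rewrite ler_pdivlMr// mulrC ler_pdivrMr//.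
apply: (le_trans phi1_ge); rewrite ler_pM2r//.
have t'tC : t' / t <= C by rewrite ler_pdivrMr.
have t't_ge0 : 0 <= t' / t by rewrite divr_ge0 ?ltW.
apply: ge0_ler_powR => //; first by rewrite divr_ge0// ltW.
by rewrite nnegrE (le_trans t't_ge0).
Qed.

(** For positive [k] this is [k <= 4 (k - log2 k)] freed of logarithms. The induction starts at 2,
    since [(k + 1) ^ 4 <= 8 * k ^ 4] fails below. *)
Lemma leq_exp4_8 (k : nat) : (k ^ 4 <= 8 ^ k)%N.
Proof.
case: k => [//|]; case=> [//|]; elim=> [//|k IHk].
rewrite [(8 ^ _)%N]expnS (leq_trans _ (leq_mul (leqnn 8) IHk))//.
by rewrite !expnS !expn0; nia.
Qed.

Lemma leq_exp2_pred (k : nat) : (0 < k -> k <= 2 ^ k.-1)%N.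
Proof. by case: k => // k _; exact: ltn_expl. Qed.

Theorem proposition4p3 (R : realType) (p : R) (M1 M2 : R -> R)
    (alpha : nat -> R)
    (p_gt0 : 0 < p) (p_le1 : p <= 1)
    (orlicz_M1 : orlicz_function (fun t : R => M1 (t `^ (1 / p))))
    (orlicz_M2 : orlicz_function (fun t : R => M2 (t `^ (1 / p))))
    (alpha_ge0 : forall i : nat, (1 <= i)%N -> 0 <= alpha i)
    (alpha_nonincreasing :
      forall i j : nat, (1 <= i)%N -> (i <= j)%N -> alpha j <= alpha i)
    (k : nat) (k_gt0 : (1 <= k)%N) :
  2 `^ (- (2 / p)) * Lambda M1 M2 alpha k <= Theta M1 M2 alpha k /\
  Theta M1 M2 alpha k <= 2 `^ (1 / p) * Lambda M1 M2 alpha k.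
Proof.
have kR_gt0 : 0 < k%:R :> R by rewrite ltr0n.
(* Common to both bounds: one of [x], [y] is an index [s], the other is [log2 (2 n / k)]. The
   condition [y <= k] keeps both arguments at least 1. *)
have term_le (C x y : R) (i j : nat) : (1 <= j)%N -> (j <= i)%N ->
    0 < x -> x <= y -> y <= k%:R -> y <= C * x ->
    alpha i * (fundamental_function M2 (k%:R / y) /
               fundamental_function M1 (k%:R / y)) <=
    C `^ (1 / p) * (alpha j * (fundamental_function M2 (k%:R / x) /
                               fundamental_function M1 (k%:R / x))).
  move=> j_gt0 ji x_gt0 xy yk yCx; have y_gt0 := lt_le_trans x_gt0 xy.
  have ky_ge1 : 1 <= k%:R / y by rewrite ler_pdivlMr// mul1r.
  have kyx : k%:R / y <= k%:R / x by rewrite ler_pM2l// lef_pV2.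
  have kxC : k%:R / x <= C * (k%:R / y).
    rewrite ler_pdivrMr// (_ : _ * x = k%:R * (C * x / y)); last by ring.
    by rewrite ler_peMr ?(ltW kR_gt0)// ler_pdivlMr// mul1r.
  have /andP[q0 q_le] := fundamental_function_ratio_le _ _ _ _ _ _ _
    p_gt0 orlicz_M1 orlicz_M2 ky_ge1 kyx kxC.
  rewrite [leRHS]mulrCA; apply: ler_pM => //; last exact: alpha_nonincreasing.
  by rewrite alpha_ge0// (leq_trans j_gt0).
have log2_ge (s m : nat) : (k * 2 ^ s <= m)%N -> s%:R <= log2 (m%:R / k%:R) :> R.
  move=> km; rewrite -[leLHS]log2_2X ler_log2 ?exprn_gt0//.
  by rewrite ler_pdivlMr// mulrC -natrX -natrM ler_nat.
have log2_le (s m : nat) : (0 < m)%N -> (m <= k * 2 ^ s)%N ->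
    log2 (m%:R / k%:R) <= s%:R :> R.
  move=> m_gt0 km; rewrite -[leRHS]log2_2X ler_log2 ?divr_gt0 ?ltr0n//.
  by rewrite ler_pdivrMr// mulrC -natrX -natrM ler_nat.
split.
  rewrite powRN ler_pdivrMl ?powR_gt0//; apply: max_range_le => // s /andP[s_gt0 sk].
  pose n := minn (k * 2 ^ s.-1) (2 ^ k.-1).
  have kn : (k <= n)%N by rewrite leq_min leq_exp2_pred// leq_pmulr// expn_gt0.
  have n_gt0 := leq_trans k_gt0 kn.
  have x_ge1 : 1 <= log2 ((2 * n)%:R / k%:R) :> R by apply: (log2_ge 1%N); lia.
  have -> : 2 `^ (2 / p) = 4 `^ (1 / p) :> R.
    rewrite (_ : 4 = 2 `^ 2); last by rewrite powR_mulrn// -natrX.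
    by rewrite -powRrM mul1r.
  apply: le_trans (ler_wpM2l (powR_ge0 _ _) (le_max_range _ k (2 ^ k.-1) _ n _)).
    apply: term_le => //.
    - exact: geq_minl.
    - exact: lt_le_trans x_ge1.
    - apply: log2_le; first lia.
      by rewrite -[in leqRHS](prednK s_gt0) expnS mulnCA leq_mul2l geq_minl.
    - by rewrite ler_nat.
    (* If the cap is inactive, the logarithm is already at least [s]. Otherwise [2 n = 2 ^ k], and
       [s <= k <= 4 * log2 (2 ^ k / k)] follows from [leq_exp4_8]. *)
    - rewrite /n; case: (leqP (k * 2 ^ s.-1) (2 ^ k.-1)) => _.
        have /log2_ge : (k * 2 ^ s <= 2 * (k * 2 ^ s.-1))%N.
          by rewrite -[in leqLHS](prednK s_gt0) expnS mulnCA.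
        have := ler0n R s; lra.
      rewrite -expnS prednK// natrX (le_trans (_ : _ <= k%:R)) ?ler_nat//.
      rewrite -log2X ?divr_gt0 ?exprn_gt0// -[leLHS]log2_2X ler_log2 ?exprn_gt0//.
      rewrite expr_div_n ler_pdivlMr ?exprn_gt0// -!natrX -natrM ler_nat.
      rewrite -expnM [(k * 4)%N](_ : _ = k + 3 * k)%N; last lia.
      by rewrite expnD expnM leq_mul2l leq_exp4_8 orbT.
  by rewrite kn geq_minr.
apply: max_range_le => [|n /andP[kn n_le]]; first exact: leq_exp2_pred.
(* Rounding the quotient down keeps the integer part of its logarithm, as powers of 2 are integers;
   [k <= n] makes [s] positive. *)
pose s := trunc_log 2 (2 * n %/ k).
have q_gt1 : (1 < 2 * n %/ k)%N by rewrite leq_divRL//; lia.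
have s_gt0 : (0 < s)%N by rewrite trunc_log_gt0.
have ks : (k * 2 ^ s <= 2 * n)%N.
  by rewrite mulnC -leq_divRL// trunc_logP// ltnW.
have sk : (2 * n < k * 2 ^ s.+1)%N.
  by rewrite [ltnRHS]mulnC -ltn_divLR// trunc_log_ltn.
have n2k : (2 * n <= 2 ^ k)%N by rewrite -[in leqRHS](prednK k_gt0) expnS leq_mul2l.
have ks1 : (k * 2 ^ s.-1 <= n)%N.
  by move: ks; rewrite -[in leqLHS](prednK s_gt0) expnS mulnCA leq_mul2l.
have s_le_k : (1 <= s <= k)%N.
  rewrite s_gt0/= -(leq_exp2l (m := 2))// (leq_trans _ n2k)// (leq_trans _ ks)//.
  exact: leq_pmull.
apply: le_trans (ler_wpM2l (powR_ge0 _ _) (le_max_range _ 1 k _ s s_le_k)).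
apply: term_le => //.
- by rewrite muln_gt0 k_gt0 expn_gt0.
- by rewrite ltr0n.
- exact: log2_ge.
- apply: log2_le; first lia.
  by rewrite (leq_trans n2k)// leq_pmull.
(* The constant 2 comes from [s + 1 <= 2 s], valid as [s] is positive. *)
- apply: (@le_trans _ _ s.+1%:R); first by apply: log2_le; lia.
  by rewrite -natrM ler_nat; lia.
Qed.
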